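(* Let $n\ge 1$, let $w_1,\ldots,w_n$ be positive real numbers with $\sum_{j=1}^n w_j\ge 1$, and for every $j=1,\ldots,n$ let $p_j(\cdot)$ be a non-constant polynomial with all coefficients real and non-negative and with $p_j(1)\ge e$. Let $b_0:=1$ and $b_k:=\sum_{j=1}^n w_j\log p_j(k)$ for $k\ge 1$. Then $\lim_{k\to\infty}b_k^{1/k}=1$.
   Context: Here $\log$ is the natural logarithm and $e$ its base. *)

(* Defs.v *)
From HB Require Import structures.
From mathcomp Require Import all_boot all_order all_algebra.
From mathcomp Require Import all_classical all_reals all_analysis.
Set Implicit Arguments.
Unset Strict Implicit.
Unset Printing Implicit Defensive.
Import Order.TTheory GRing.Theory Num.Theory.
Import numFieldNormedType.Exports.
Local Open Scope ring_scope.

Definition log_sum (R : realType) (n : nat) (w : 'I_n -> R)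
    (p : 'I_n -> {poly R}) (k : nat) : R :=
  if k == 0%N then 1 else \sum_(j < n) w j * ln (p j).[k%:R].

(* Main.v *)
(* All coefficients being non-negative, [p_j(1) <= p_j(k) <= p_j(1) k^(size p_j)],
   so [1 <= b_k <= C k] for a constant [C]. Hence [0 <= ln b_k / k], and
   [ln b_k = 2 ln (sqrt b_k) <= 2 sqrt (C k)] makes this quotient at most
   [2 sqrt (C / k)], which tends to [0]. *)
Require Import Defs.
From HB Require Import structures.
From mathcomp Require Import all_boot all_order all_algebra.
From mathcomp Require Import all_classical all_reals all_analysis.
Set Implicit Arguments.
Unset Strict Implicit.
Unset Printing Implicit Defensive.
Import Order.TTheory GRing.Theory Num.Theory.
Import numFieldNormedType.Exports.
Local Open Scope classical_set_scope.
Local Open Scope ring_scope.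

Lemma horner_nneg_ge_horner1 (R : numDomainType) (p : {poly R}) (x : R) :
  (forall i, 0 <= p`_i) -> 1 <= x -> p.[1] <= p.[x].
Proof.
move=> p0 x1; rewrite !horner_coef; apply: ler_sum => i _.
by rewrite expr1n ler_wpM2l// exprn_ege1.
Qed.

(** Every exponent in the expansion of [p] is below [size p], so for [1 <= x] each power of [x] is
    at most [x ^+ size p]. *)
Lemma horner_nneg_le_horner1 (R : numDomainType) (p : {poly R}) (x : R) :
  (forall i, 0 <= p`_i) -> 1 <= x -> p.[x] <= p.[1] * x ^+ size p.
Proof.
move=> p0 x1; rewrite !horner_coef mulr_suml; apply: ler_sum => i _.
by rewrite expr1n mulr1 ler_wpM2l// ler_weXn2l// ltnW.
Qed.

(** Apply [ln y < y] at the square root of [x]. The exponent 1/2 matters: [ln x < x] itself would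
    only bound [ln (u k) / k] by a constant below. *)
Lemma ln_le_sqrt (R : realType) (x : R) : 0 < x -> ln x <= 2 * Num.sqrt x.
Proof.
move=> x0; have sx0 : 0 < Num.sqrt x by rewrite sqrtr_gt0.
rewrite -[X in ln X](sqr_sqrtr (ltW x0)) lnXn// -[leLHS]mulr_natl.
by rewrite ler_pM2l// ltW// ln_sublinear.
Qed.

(** The root is the exponential of [k%:R^-1 * ln (u k)], and this exponent is squeezed to 0. *)
Lemma cvg_root_linear_growth (R : realType) (u : nat -> R) (C : R) :
  (forall k, (0 < k)%N -> 1 <= u k <= C * k%:R) ->
  u k `^ (k%:R^-1) @[k --> \oo] --> (1 : R).
Proof.
move=> uC.
have kV0 : (k%:R^-1 : R) @[k --> \oo] --> (0 : R).
  (* The harmonic sequence is [1 / (k + 1)], hence the shift by one. *)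
  by rewrite -cvg_shiftS; exact: cvg_harmonic.
have sqrt0 : 2 * Num.sqrt (C * k%:R^-1) @[k --> \oo] --> (0 : R).
  have : 2 * Num.sqrt (C * k%:R^-1) @[k --> \oo] --> 2 * Num.sqrt (C * 0).
    apply: cvgMr; apply: continuous_cvg; first exact: sqrt_continuous.
    exact: cvgMr.
  by rewrite mulr0 sqrtr0 mulr0.
have lnu0 : k%:R^-1 * ln (u k) @[k --> \oo] --> (0 : R).
  apply: (squeeze_cvgr _ (cvg_cst 0) sqrt0).
  near=> k; have k0 : (0 < k)%N by near: k; exact: nbhs_infty_gt.
  have /andP[u1 uk] := uC _ k0.
  have u0 : 0 < u k by exact: lt_le_trans u1.
  have kR0 : 0 < k%:R :> R by rewrite ltr0n.
  rewrite mulr_ge0 ?invr_ge0 ?ln_ge0//= ler_pdivrMl//.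
  rewrite (le_trans (ln_le_sqrt u0))// mulrCA ler_pM2l//.
  (* Move the factor [k] under the root as [k ^ 2]; there [k ^ 2 * (C / k) = C * k], the bound on
     [u k]. *)
  rewrite -[X in X * _](ger0_norm (ltW kR0)) -sqrtr_sqr.
  rewrite -sqrtrM ?sqr_ge0// ler_wsqrtr// (le_trans uk)//.
  by rewrite mulrCA expr2 mulfK ?gt_eqF.
have : expR (k%:R^-1 * ln (u k)) @[k --> \oo] --> expR (0 : R).
  by apply: continuous_cvg => //; exact: continuous_expR.
rewrite expR0; apply: cvg_trans; apply: near_eq_cvg; near=> k.
have k0 : (0 < k)%N by near: k; exact: nbhs_infty_gt.
have /andP[u1 _] := uC _ k0.
have u0 : 0 < u k by exact: lt_le_trans u1.
(* A nonzero base selects the exponential branch of [powR]. *)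
by rewrite /powR gt_eqF.
Unshelve. all: by end_near.
Qed.

(** The logarithm of the upper bound is [ln p.[1] + size p * ln x]; use [ln x < x], and [1 <= x]
    with [0 <= ln p.[1]]. *)
Lemma ln_horner_le_linear (R : realType) (p : {poly R}) (x : R) :
  (forall i, 0 <= p`_i) -> 1 <= p.[1] -> 1 <= x ->
  ln p.[x] <= (ln p.[1] + (size p)%:R) * x.
Proof.
move=> p0 p1 x1; have x0 : 0 < x by exact: lt_le_trans x1.
have p10 : 0 < p.[1] by exact: lt_le_trans p1.
have xn0 : 0 < x ^+ size p by rewrite exprn_gt0.
have px0 : 0 < p.[x] by exact: lt_le_trans (horner_nneg_ge_horner1 p0 x1).
apply: (@le_trans _ _ (ln (p.[1] * x ^+ size p))).
  by rewrite ler_ln ?posrE ?mulr_gt0// horner_nneg_le_horner1.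
rewrite lnM ?posrE// lnXn// mulrDl lerD//.
  by rewrite ler_peMr// ln_ge0.
by rewrite -[leLHS]mulr_natl ler_wpM2l// ltW// ln_sublinear.
Qed.

Theorem corollary4 (R : realType) (n : nat) (hn : (1 <= n)%N)
    (w : 'I_n -> R) (p : 'I_n -> {poly R})
    (w_gt0 : forall j, 0 < w j)
    (w_sum : 1 <= \sum_(j < n) w j)
    (p_nonconst : forall j, (1 < size (p j))%N)
    (p_coef_ge0 : forall j i, 0 <= (p j)`_i)
    (p1_ge_e : forall j, expR 1 <= (p j).[1]) :
  log_sum w p k `^ (k%:R^-1) @[k --> \oo] --> (1 : R).
Proof.
have e1 : 1 <= expR 1 :> R by rewrite -(@expR0 R) ler_expR.
have p1 j : 1 <= (p j).[1] by exact: le_trans (p1_ge_e j).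
(* The growth constant is the weighted sum of the linear constants of the [p j]. *)
apply: (@cvg_root_linear_growth _ _
  (\sum_(j < n) w j * (ln (p j).[1] + (size (p j))%:R))) => k k0.
have k1 : 1 <= k%:R :> R by rewrite ler1n.
rewrite /log_sum gtn_eqF//; apply/andP; split.
  apply: le_trans w_sum _; apply: ler_sum => j _.
  (* Each logarithm is at least 1 = [ln (expR 1)], since [p j] at [k] is at least its value at 1,
     hence at least [expR 1]. *)
  rewrite ler_peMr ?(ltW (w_gt0 j))// -[leLHS](expRK 1) ler_ln ?posrE ?expR_gt0//.
    exact: le_trans (p1_ge_e j) (horner_nneg_ge_horner1 (p_coef_ge0 j) k1).
  apply: lt_le_trans (horner_nneg_ge_horner1 (p_coef_ge0 j) k1).
  exact: lt_le_trans (p1 j).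
rewrite mulr_suml; apply: ler_sum => j _.
by rewrite -mulrA ler_wpM2l ?(ltW (w_gt0 j))// ln_horner_le_linear.
Qed.
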